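(* Let $n\ge1$, $0\le q\le 1$, and consider the PASEP Markov chain on $\{\circ,\bullet\}^n$ with $\alpha=\beta=1$. In its (unique) stationary distribution, for each $0\le k\le n$ the probability that the chain is in a configuration with exactly $k$ black particles $\bullet$ equals $\hat{E}_{k+1,n+1}(q)/Z_n$.
   Context: The PASEP on $n$ cells has state space the words of length $n$ over $\{\circ,\bullet\}$ (black particles $\bullet$, empty cells $\circ$), with parameters $\alpha,\beta,q$. Transition probabilities $P_{X,Y}$: if $X=A\bullet\circ B$ and $Y=A\circ\bullet B$ then $P_{X,Y}=1/(n+1)$ and $P_{Y,X}=q/(n+1)$; if $X=\circ B$ and $Y=\bullet B$ then $P_{X,Y}=\alpha/(n+1)$; if $X=B\bullet$ and $Y=B\circ$ then $P_{X,Y}=\beta/(n+1)$; all other $P_{X,Y}$ with $Y\ne X$ are $0$, and $P_{X,X}=1-\sum_{Y\ne X}P_{X,Y}$. A bicolored Motzkin path of length $n$ is a word $c=(c_1,\dots,c_n)$ over $\{N,S,E,\bar E\}$ such that, with $h_i=|\{j<i:c_j=N\}|-|\{j<i : c_j=S\}|$ (the starting height of step $i$), $h_i\ge0$ for all $i$ and $h_{n+1}=0$. Let $[k]_q=1+q+\cdots+q^{k-1}$ and $Z_n=\sum_{c}\prod_{i=1}^n[h_i+1]_q$, the sum over all bicolored Motzkin paths of length $n$. For $N\ge1$, $1\le K\le N$, $$\hat{E}_{K,N}(q)=q^{K-K^2}\sum_{i=0}^{K-1}(-1)^i [K-i]_q^N\, q^{K(i-1)}\left( \binom{N}{i}q^{K-i}+\binom{N}{i-1}\right),$$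 with $\binom{N}{-1}=0$; this expression is a polynomial in $q$, and $\hat E_{K,N}(q)$ denotes its value at the given $q$. *)

(* Defs.v *)
From HB Require Import structures.
From mathcomp Require Import all_boot all_order all_algebra.

Set Implicit Arguments.
Unset Strict Implicit.
Unset Printing Implicit Defensive.

Import Order.TTheory GRing.Theory Num.Theory.

Local Open Scope ring_scope.

(* A configuration: [true] is a black particle, [false] an empty cell.        *)
Definition state (n : nat) := n.-tuple bool.

Definition nblack n (X : state n) : nat := count_mem true X.

(* X = A ++ [true; false] ++ B and Y = A ++ [false; true] ++ B; necessarily   *)
(* A = take i X and B = drop i.+2 X, where i is the size of A.                *)
Definition hop n (X Y : state n) : bool :=
  [exists i : 'I_n,
    (tval X == take i X ++ [:: true; false] ++ drop i.+2 X) &&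
    (tval Y == take i X ++ [:: false; true] ++ drop i.+2 X)].

Definition enter n (X Y : state n) : bool :=
  (tval X == false :: behead X) && (tval Y == true :: behead X).

Definition leave n (X Y : state n) : bool :=
  (tval X == rcons (take n.-1 X) true) && (tval Y == rcons (take n.-1 X) false).

(* For X != Y at most one of the four tests holds, so their order is          *)
(* irrelevant.                                                                *)
Definition pasep_off (R : fieldType) (alpha beta q : R) n (X Y : state n) : R :=
  if hop X Y then 1 / n.+1%:R
  else if hop Y X then q / n.+1%:R
  else if enter X Y then alpha / n.+1%:R
  else if leave X Y then beta / n.+1%:R
  else 0.

Definition pasep (R : fieldType) (alpha beta q : R) n (X Y : state n) : R :=
  if X == Y then 1 - \sum_(Y' : state n | Y' != X) pasep_off alpha beta q X Y'
  else pasep_off alpha beta q X Y.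

Definition stationary (R : numDomainType) (T : finType) (P : T -> T -> R)
    (mu : {ffun T -> R}) : Prop :=
  [/\ forall X, 0 <= mu X, \sum_X mu X = 1
    & forall Y, \sum_X mu X * P X Y = mu Y].

Variant step := sN | sS | sE | sEbar.

Definition step_code (s : step) : bool * bool :=
  match s with
  | sN => (true, true) | sS => (true, false)
  | sE => (false, true) | sEbar => (false, false)
  end.

Definition step_decode (b : bool * bool) : step :=
  match b with
  | (true, true) => sN | (true, false) => sS
  | (false, true) => sE | (false, false) => sEbar
  end.

Lemma step_codeK : cancel step_code step_decode.
Proof. by case. Qed.

HB.instance Definition _ := Countable.copy step (can_type step_codeK).
HB.instance Definition _ : isFinite step := CanIsFinite step_codeK.

(* Starting height of the step of 0-based index i; [height c n] is the final  *)
(* height of a path of length n.                                              *)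
Definition height n (c : n.-tuple step) (i : nat) : int :=
  (count_mem sN (take i c))%:Z - (count_mem sS (take i c))%:Z.

Definition motzkin n (c : n.-tuple step) : bool :=
  [forall i : 'I_n, 0 <= height c i] && (height c n == 0).

Definition qnum (R : nzRingType) (q : R) (k : nat) : R := \sum_(j < k) q ^+ j.

(* The absolute value only converts the nonnegative heights of a Motzkin path *)
(* to nat.                                                                    *)
Definition Zpart (R : comNzRingType) (n : nat) (q : R) : R :=
  \sum_(c : n.-tuple step | motzkin c)
    \prod_(i < n) qnum q (`|height c i|%N).+1.

(* 'C(N, i - 1), which is 0 for i = 0. *)
Definition binpred (N i : nat) : nat := if i is j.+1 then 'C(N, j) else 0%N.

(* The expression has negative powers of q, so it is formed in the field of   *)
(* fractions of R[q]; this gives its polynomial a value at q = 0.             *)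
Definition Ehat (R : idomainType) (K N : nat) : {fraction {poly R}} :=
  let q : {fraction {poly R}} := tofrac 'X in
  q ^ (K%:Z - (K ^ 2)%N%:Z) *
  \sum_(i < K)
    (-1) ^+ i * qnum q (K - i) ^+ N * q ^ (K%:Z * (i%:Z - 1)) *
    ('C(N, i)%:R * q ^+ (K - i) + (binpred N i)%:R).

(* Main.v *)
(* Matrix ansatz: bidiagonal D, E with DE = qED + D + E, <W|E = <W|,
   D|V> = |V> give the stationary weight <W|X|V> of a word X, and expanding
   (D + E)^n over paths gives Z_n. Uniqueness holds because every
   configuration can drain to the empty one at rates independent of q.
   To count black particles put A = yD + E. The row vectors
   u_m = <W|(D + [1]/q) ... (D + [m]/q^m) satisfy u_m E = [m+1] u_m, hence
   u_m A = lambda_{m+1} u_m + y u_{m+1} with lambda_j = [j](1 - y q^-j).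
   Grouping the double sum in Ehat by j = K - i shows that
     \sum_K y^K Ehat_{K,N} = \sum_j omega_j lambda_j^N
   with omega_j = y^j q^(-j^2) (q^j - y q^-j), as power series in y.
   The sums of
   omega_j lambda_j^n \prod_(i <= m) (lambda_j - lambda_i) obey the same
   recursion in n as y^(m+1) u_m A^n |V>, and agree with them at n = 0, which
   is a q-hypergeometric summation proved by a WZ certificate. *)
Require Import Defs.
From mathcomp Require Import all_boot all_order all_algebra.
From mathcomp Require Import ring lra zify.
From Stdlib Require Import FunctionalExtensionality.

Set Implicit Arguments.
Unset Strict Implicit.
Unset Printing Implicit Defensive.

Import Order.TTheory GRing.Theory Num.Theory.
Local Open Scope ring_scope.

(** * q-integers *)

Lemma qnum0 (B : nzRingType) (q : B) : qnum q 0 = 0.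
Proof. by rewrite /qnum big_ord0. Qed.

Lemma qnumSr (B : nzRingType) (q : B) k : qnum q k.+1 = qnum q k + q ^+ k.
Proof. by rewrite /qnum big_ord_recr. Qed.

Lemma qnumS (B : nzRingType) (q : B) k : qnum q k.+1 = 1 + q * qnum q k.
Proof.
rewrite /qnum big_ord_recl expr0 mulr_sumr; congr (_ + _).
by apply: eq_bigr => i _; rewrite exprS.
Qed.

Lemma qnum1 (B : nzRingType) (q : B) : qnum q 1 = 1.
Proof. by rewrite qnumS qnum0 mulr0 addr0. Qed.

Lemma rmorph_qnum (B C : nzRingType) (f : {rmorphism B -> C}) q k :
  f (qnum q k) = qnum (f q) k.
Proof.
by rewrite /qnum rmorph_sum; apply: eq_bigr => i _; rewrite rmorphXn.
Qed.

(** * The matrix ansatz and the weights of words *)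

(* Infinite column vectors; D, E below are the bidiagonal solution of the
   matrix ansatz with <W| and |V> both the first basis vector. *)
Definition vec (B : comNzRingType) := nat -> B.

Definition opD (B : comNzRingType) (q : B) (v : vec B) : vec B :=
  fun h => qnum q h.+1 * (v h + v h.+1).

Definition opE (B : comNzRingType) (q : B) (v : vec B) : vec B :=
  fun h => qnum q h.+1 * (v h + if h is h'.+1 then v h' else 0).

Definition lin (B : comNzRingType) (a : B) (u : vec B) (b : B) (v : vec B) :
  vec B := fun h => a * u h + b * v h.

Definition vac (B : comNzRingType) : vec B := fun h => (h == 0%N)%:R.

Lemma opD_lin (B : comNzRingType) (q a b : B) u v :
  opD q (lin a u b v) = lin a (opD q u) b (opD q v).
Proof. by apply: functional_extensionality => h; rewrite /opD /lin; ring. Qed.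

Lemma opE_lin (B : comNzRingType) (q a b : B) u v :
  opE q (lin a u b v) = lin a (opE q u) b (opE q v).
Proof.
by apply: functional_extensionality => -[|h]; rewrite /opE /lin; ring.
Qed.

(** Compared entry by entry, both sides agree by [[k+1] = 1 + q[k]]. *)
Lemma opDE (B : comNzRingType) (q : B) v :
  opD q (opE q v) = lin 1 (lin q (opE q (opD q v)) 1 (opD q v)) 1 (opE q v).
Proof.
apply: functional_extensionality => -[|h]; rewrite /opD /opE /lin.
  by rewrite !qnumS qnum0; ring.
by rewrite !(qnumS q h.+2) !(qnumS q h.+1) !(qnumS q h); ring.
Qed.

Lemma opD_vac (B : comNzRingType) (q : B) : opD q (@vac B) = @vac B.
Proof.
apply: functional_extensionality => -[|h]; rewrite /opD /vac /=.
  by rewrite qnum1 addr0 mul1r.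
by rewrite addr0 mulr0.
Qed.

Lemma opE_0 (B : comNzRingType) (q : B) v : opE q v 0%N = v 0%N.
Proof. by rewrite /opE qnum1 mul1r addr0. Qed.

Definition act (B : comNzRingType) (q : B) (s : seq bool) (v : vec B) : vec B :=
  foldr (fun b => if b then opD q else opE q) v s.

Definition wt (B : comNzRingType) (q : B) (s : seq bool) : B :=
  act q s (@vac B) 0%N.

Lemma act_cat (B : comNzRingType) (q : B) s t v :
  act q (s ++ t) v = act q s (act q t v).
Proof. exact: foldr_cat. Qed.

Lemma act_lin (B : comNzRingType) (q : B) s a u b v :
  act q s (lin a u b v) = lin a (act q s u) b (act q s v).
Proof. by elim: s => //= -[] s ->; rewrite (opD_lin, opE_lin). Qed.

Lemma wt_bulk (B : comNzRingType) (q : B) s t :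
  wt q (s ++ [:: true, false & t]) =
    q * wt q (s ++ [:: false, true & t])
    + wt q (s ++ true :: t) + wt q (s ++ false :: t).
Proof.
rewrite /wt !act_cat /= opDE !act_lin /lin.
by rewrite !mul1r.
Qed.

Lemma wt_left (B : comNzRingType) (q : B) s : wt q (false :: s) = wt q s.
Proof. exact: opE_0. Qed.

Lemma wt_right (B : comNzRingType) (q : B) s : wt q (rcons s true) = wt q s.
Proof. by rewrite /wt -cats1 act_cat /= opD_vac. Qed.

Lemma rmorph_act (B C : comNzRingType) (f : {rmorphism B -> C}) q s v h :
  f (act q s v h) = act (f q) s (f \o v) h.
Proof.
elim: s h => //= -[] s IHs h;
  rewrite /opD /opE rmorphM rmorphD rmorph_qnum ?IHs //.
by case: h => [|h]; rewrite ?rmorph0 ?IHs.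
Qed.

(** Weights are polynomials in [q], so those computed at ['X] specialise both to the fraction field
    and to a numerical [q], including 0 and 1. *)
Lemma rmorph_wt (B C : comNzRingType) (f : {rmorphism B -> C}) q s :
  f (wt q s) = wt (f q) s.
Proof.
rewrite rmorph_act /wt; congr (act _ _ _ _).
by apply: functional_extensionality => h; rewrite /= rmorph_nat.
Qed.

Lemma wt_ge0 (R : realFieldType) (q : R) s : 0 <= q -> 0 <= wt q s.
Proof.
move=> q0; have qn k : 0 <= qnum q k.
  by apply: sumr_ge0 => i _; rewrite exprn_ge0.
rewrite /wt; elim: s 0%N => [|b s IHs] h; first exact: ler0n.
case: b => /=; rewrite /opD /opE mulr_ge0 // addr_ge0 //.
by case: h => [|h]; [exact: lexx | exact: IHs].
Qed.

(** * Generating function in the number of black particles *)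

Definition opA (B : comNzRingType) (q y : B) (v : vec B) : vec B :=
  lin y (opD q v) 1 (opE q v).

Definition iterA (B : comNzRingType) (q y : B) n := iter n (opA q y) (@vac B).

Lemma big_tupleS (I : finType) (B : nmodType) n (F : seq I -> B) :
  \sum_(c : n.+1.-tuple I) F c = \sum_i \sum_(c : n.-tuple I) F (i :: c).
Proof.
rewrite pair_bigA /=.
rewrite (reindex (fun p : I * n.-tuple I => [tuple of p.1 :: p.2])) //=.
exists (fun c => (thead c, [tuple of behead c])).
  by move=> [i c] _ /=; rewrite theadE; congr pair; apply: val_inj.
by move=> c _; rewrite [RHS]tuple_eta.
Qed.

Lemma iterAE (B : comNzRingType) (q y : B) n h :
  iterA q y n h =
    \sum_(X : n.-tuple bool) y ^+ count_mem true X * act q X (@vac B) h.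
Proof.
elim: n h => [|n IHn] h.
  rewrite (big_pred1 [tuple]) ?expr0 ?mul1r // => c /=.
  by rewrite tuple0; apply/esym/eqP.
rewrite (big_tupleS n (fun s => y ^+ count_mem true s * act q s (@vac B) h)).
rewrite big_bool /iterA iterS -/(iterA q y n) /opA /lin mul1r.
have eqt : iterA q y n = fun h =>
   \sum_(X : n.-tuple bool) y ^+ count_mem true X * act q X (@vac B) h.
  exact: functional_extensionality.
rewrite {1}/opD {1}/opE !eqt; congr (_ + _).
  rewrite -big_split /= !mulr_sumr; apply: eq_bigr => X _.
  by rewrite add1n exprS /opD; ring.
case: h => [|h].
  rewrite addr0 mulr_sumr; apply: eq_bigr => X _ /=.
  by rewrite /opE add0n; ring.
rewrite -big_split /= !mulr_sumr; apply: eq_bigr => X _.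
by rewrite add0n /opE; ring.
Qed.

(** * Left eigenvectors of [E] *)

(* phi m v = <W| (D + c_1) ... (D + c_m) v, with c_i = [i]/q^i chosen so that
   these row vectors are eigenvectors of E (phi_opE). *)
Fixpoint phi (K : comUnitRingType) (q : K) m (v : vec K) : K :=
  if m is m'.+1 then phi q m' (lin 1 (opD q v) (qnum q m / q ^+ m) v)
  else v 0%N.

Lemma phi_lin (K : comUnitRingType) (q : K) m a u b v :
  phi q m (lin a u b v) = a * phi q m u + b * phi q m v.
Proof.
elim: m u v => //= m IHm u v; set c := (_ / _).
rewrite -!IHm; congr phi; rewrite opD_lin.
by apply: functional_extensionality => h; rewrite /lin; ring.
Qed.

Lemma qnum_shift (K : comUnitRingType) (q : K) m : q \is a GRing.unit ->
  1 + qnum q m / q ^+ m = qnum q m.+1 / q ^+ m.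
Proof. by move=> uq; rewrite qnumSr mulrDl divrr ?unitrX // addrC. Qed.

Lemma phi_opE (K : comUnitRingType) (q : K) m v : q \is a GRing.unit ->
  phi q m (opE q v) = qnum q m.+1 * phi q m v.
Proof.
move=> uq; elim: m v => [|m IHm] v; first by rewrite /= opE_0 qnum1 mul1r.
rewrite [LHS]/= [phi q m.+1 v]/=.
rewrite opDE !phi_lin !IHm (qnumS q m.+1).
have := qnum_shift m.+1 uq; rewrite (qnumS q m.+1); set c := (X in 1 + X) => E.
(* Moving [E] to the left past [D + c] leaves this combination. The first coefficient is [[m+2]],
   and the choice [c = [m+1]/q^(m+1)] is what makes [(1 + c)[m+1] = [m+2] c]. *)
transitivity ((1 + q * qnum q m.+1) * phi q m (opD q v)
  + (1 + c) * qnum q m.+1 * phi q m v); first by rewrite /c; ring.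
by rewrite E /c; ring.
Qed.

Lemma phi_opA (K : comUnitRingType) (q y : K) m v : q \is a GRing.unit ->
  phi q m (opA q y v) = y * phi q m.+1 v
     + qnum q m.+1 * (1 - y / q ^+ m.+1) * phi q m v.
Proof.
move=> uq; rewrite /opA phi_lin phi_opE //= phi_lin.
by set c := _^-1; ring.
Qed.

(** [D] fixes the vacuum, so each factor [D + c_i] acts on it as [1 + c_i = [i+1]/q^i]. *)
Lemma phi_vac (K : comUnitRingType) (q : K) m : q \is a GRing.unit ->
  phi q m (@vac K) = \prod_(i < m) (qnum q i.+2 / q ^+ i.+1).
Proof.
move=> uq; elim: m => [|m IHm]; first by rewrite big_ord0.
rewrite big_ord_recr /= phi_lin opD_vac IHm -qnum_shift //.
by set c := _ / _; ring.
Qed.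

(** * Moments over the eigenvalues of [yD + E] *)

(* The eigenvalues of yD + E, with y = 'X. *)
Definition lam (K : fieldType) (q : K) j : {poly K} :=
  (qnum q j)%:P * (1 - (q ^- j)%:P * 'X).

(* The coefficients of \sum_(j < J) omega q j * lam q j ^+ N below 'X^J are
   the Ehat_{K,N}: group the double sum defining them by j = K - i. *)
Definition omega (K : fieldType) (q : K) j : {poly K} :=
  (q ^- (j ^ 2))%:P * 'X^j * ((q ^+ j)%:P - (q ^- j)%:P * 'X).

Definition moment (K : fieldType) (q : K) J n m : {poly K} :=
  \sum_(j < J) omega q j * lam q j ^+ n * \prod_(i < m) (lam q j - lam q i).

(** Write one factor [lam q j] as [(lam q j - lam q m) + lam q m]. With [m.+1] for [m], this is the
    recursion [phi_opA] multiplied by ['X^(m.+1)]. *)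
Lemma momentS (K : fieldType) (q : K) J n m :
  moment q J n.+1 m = moment q J n m.+1 + lam q m * moment q J n m.
Proof.
rewrite /moment mulr_sumr -big_split; apply: eq_bigr => j _ /=.
by rewrite big_ord_recr exprS /=; ring.
Qed.

(** The sum telescopes: [omega q j = t_j - t_(j+1)] with [t_j = q^(j - j^2) 'X^j] and [t_0 = 1]. *)
Lemma moment00 (K : fieldType) (q : K) J : q != 0 ->
  'X^J %| moment q J 0 0 - 1.
Proof.
move=> q0; have -> : moment q J 0 0 = 1 - (q ^+ J * q ^- (J ^ 2))%:P * 'X^J.
  elim: J => [|J IHJ].
    by rewrite /moment big_ord0 expr0 invr1 !mulr1 subrr.
  rewrite /moment big_ord_recr /= -/(moment q J 0 0) IHJ big_ord0 expr0 !mulr1.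
  have -> : q ^+ J.+1 * q ^- (J.+1 ^ 2) = q ^- J * q ^- (J ^ 2).
    have qX k : q ^+ k != 0 by rewrite expf_neq0.
    rewrite -!invfM -!exprD.
    have -> : (J.+1 ^ 2 = J.+1 + (J + J ^ 2))%N by rewrite !expnS !expn0; ring.
    by rewrite (exprD q J.+1) invfM mulVKf.
  by rewrite exprS /omega !polyCM; ring.
by rewrite addrAC subrr add0r dvdpNr dvdp_mull.
Qed.

(** The difference [[j] - [i]] for [q != 1], in a closed form suited to [field]. *)
Definition gapq (K : fieldType) (q : K) j i := (q ^+ i - q ^+ j) / (1 - q).

Lemma qnumE (K : fieldType) (q : K) k : q != 1 ->
  qnum q k = (1 - q ^+ k) / (1 - q).
Proof.
move=> q1; have q1' : 1 - q != 0 by rewrite subr_eq0 eq_sym.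
elim: k => [|k IHk]; first by rewrite qnum0 expr0 subrr mul0r.
by rewrite qnumSr IHk exprS; field.
Qed.

(** The linear coefficient factors because [[j]/q^j - [i]/q^i = ([j] - [i])/q^(i+j)]. *)
Lemma lamB (K : fieldType) (q : K) i j : q != 0 -> q != 1 ->
  lam q j - lam q i =
    (gapq q j i)%:P * (1 - (q ^- i * q ^- j)%:P * 'X).
Proof.
move=> q0 q1; have q1' : 1 - q != 0 by rewrite subr_eq0 eq_sym.
have qi : q ^+ i != 0 by rewrite expf_neq0.
have qj : q ^+ j != 0 by rewrite expf_neq0.
rewrite /lam !mulrBr !mulrA !mulr1 -!polyCM.
have -> : gapq q j i * (q ^- i * q ^- j) =
    qnum q j / q ^+ j - qnum q i / q ^+ i.
  by rewrite !qnumE // /gapq; field; rewrite qi qj q1'.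
have -> : gapq q j i = qnum q j - qnum q i.
  by rewrite !qnumE // /gapq; field.
by rewrite !polyCB; ring.
Qed.

(* WZ certificate for the recursion of [moment q J 0] in its last argument. *)
Definition cert (K : fieldType) (q : K) m j : {poly K} :=
  (q ^- (j ^ 2) * q ^+ j)%:P * 'X^j * (1 - (q * q ^- j)%:P * 'X)
  * \prod_(i < m.+1) (gapq q j i)%:P
  * \prod_(i < m) (1 - (q ^- i * q ^- j)%:P * 'X).

(** This is the certificate identity stripped of its common factors, a quadratic in ['X]. The
    constant terms agree on sight; [c1] and [c2] compare the other two coefficients. *)
Lemma cert_quadratic (K : fieldType) (q : K) m j : q != 0 -> q != 1 ->
  ((q ^+ j)%:P - (q ^- j)%:P * 'X) *
    ((gapq q j m)%:P * (1 - (q ^- m * q ^- j)%:P * 'X)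
     - 'X * (qnum q m.+1 / q ^+ m)%:P)
  = (q ^+ j)%:P * (1 - (q * q ^- j)%:P * 'X) * (gapq q j m)%:P
    - (q ^- j)%:P * 'X * (qnum q j.+1 * q ^+ m)%:P
      * (1 - (q ^- m * q ^- j)%:P * 'X) :> {poly K}.
Proof.
move=> q0 q1; have q1' : 1 - q != 0 by rewrite subr_eq0 eq_sym.
have qj : q ^+ j != 0 by rewrite expf_neq0.
have qm : q ^+ m != 0 by rewrite expf_neq0.
set g := gapq q j m; set r := q ^- m * q ^- j; set c := qnum q m.+1 / q ^+ m.
have c1 : q ^+ j * (g * r) + q ^+ j * c + q ^- j * g =
    q ^+ j * (q * q ^- j) * g + q ^- j * (qnum q j.+1 * q ^+ m).
  by rewrite /c !qnumE // /g /gapq /r !exprS; field; rewrite q1' qj qm.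
have c2 : q ^- j * (g * r) + q ^- j * c =
    q ^- j * (qnum q j.+1 * q ^+ m) * r.
  by rewrite /c !qnumE // /g /gapq /r !exprS; field; rewrite q1' qj qm.
transitivity ((q ^+ j * g)%:P
  - (q ^+ j * (g * r) + q ^+ j * c + q ^- j * g)%:P * 'X
  + (q ^- j * (g * r) + q ^- j * c)%:P * 'X * 'X).
  by clearbody g r c; rewrite !polyCD !polyCM; ring.
by rewrite c1 c2; clearbody g r c; rewrite !polyCD !polyCM; ring.
Qed.

Lemma cert_step (K : fieldType) (q : K) m j : q != 0 -> q != 1 ->
  omega q j * \prod_(i < m.+1) (lam q j - lam q i)
  - 'X * (qnum q m.+1 / q ^+ m)%:P
    * (omega q j * \prod_(i < m) (lam q j - lam q i))
  = cert q m j - cert q m j.+1.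
Proof.
move=> q0 q1; have q1' : 1 - q != 0 by rewrite subr_eq0 eq_sym.
have qj : q ^+ j != 0 by rewrite expf_neq0.
have qm : q ^+ m != 0 by rewrite expf_neq0.
have Elam k : \prod_(i < k) (lam q j - lam q i) =
    \prod_(i < k) (gapq q j i)%:P
    * \prod_(i < k) (1 - (q ^- i * q ^- j)%:P * 'X).
  by rewrite -big_split; apply: eq_bigr => i _; rewrite lamB.
(* Replacing [j] by [j+1] turns factor [i] into factor [i+1]; the linear prefactor in [cert]
   supplies the missing factor [i = 0]. *)
have E1 : (1 - (q * q ^- j.+1)%:P * 'X)
      * \prod_(i < m) (1 - (q ^- i * q ^- j.+1)%:P * 'X)
    = \prod_(i < m) (1 - (q ^- i * q ^- j)%:P * 'X)
      * (1 - (q ^- m * q ^- j)%:P * 'X).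
  transitivity (\prod_(i < m.+1) (1 - (q ^- i * q ^- j)%:P * 'X)); last first.
    by rewrite big_ord_recr.
  rewrite big_ord_recl /= expr0 invr1 mul1r exprS invfM mulVKf //.
  congr (_ * _).
  apply: eq_bigr => i _; rewrite /bump add1n (exprS q i) invfM.
  by rewrite mulrCA mulrA.
(* The factor [i = 0] is [[j+1]], and each later one is [q] times a gap for [j]. *)
have E2 : \prod_(i < m.+1) (gapq q j.+1 i)%:P =
    (qnum q j.+1 * q ^+ m)%:P * \prod_(i < m) (gapq q j i)%:P.
  rewrite big_ord_recl (polyCM (qnum _ _)) -mulrA; congr (_ * _).
    by rewrite /gapq /= expr0 qnumE.
  rewrite -[m in q ^+ m]card_ord -prodr_const rmorph_prod -big_split /=.
  apply: eq_bigr => i _.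
  by rewrite /bump add1n -polyCM /gapq !exprS -mulrBr mulrA.
rewrite !Elam /cert E2 !big_ord_recr /=.
set P := \prod_(i < m) (gapq q j i)%:P.
set Q := \prod_(i < m) (1 - (q ^- i * q ^- j)%:P * 'X) in E1 *.
set Q' := \prod_(i < m) _ in E1 *.
have -> : (q ^- (j.+1 ^ 2) * q ^+ j.+1)%:P * 'X^(j.+1) *
    (1 - (q * q ^- j.+1)%:P * 'X) * ((qnum q j.+1 * q ^+ m)%:P * P) * Q' =
    (q ^- (j.+1 ^ 2) * q ^+ j.+1)%:P * 'X^(j.+1)
    * ((qnum q j.+1 * q ^+ m)%:P * P)
    * ((1 - (q * q ^- j.+1)%:P * 'X) * Q') by ring.
rewrite E1 /omega.
have -> : q ^- (j.+1 ^ 2) * q ^+ j.+1 = q ^- (j ^ 2) * q ^- j.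
  have -> : (j.+1 ^ 2 = j.+1 + (j + j ^ 2))%N by rewrite !expnS !expn0; ring.
  rewrite (exprD q j.+1) invfM mulrAC mulVf ?expf_neq0 // mul1r.
  by rewrite exprD invfM mulrC.
transitivity ((q ^- (j ^ 2))%:P * 'X^j * P * Q *
  (((q ^+ j)%:P - (q ^- j)%:P * 'X) *
   ((gapq q j m)%:P * (1 - (q ^- m * q ^- j)%:P * 'X)
    - 'X * (qnum q m.+1 / q ^+ m)%:P))); first by ring.
by rewrite cert_quadratic // exprS !polyCM; ring.
Qed.

(** Summing [cert_step] over [j < J] telescopes to [cert q m 0 - cert q m J]. The first term
    vanishes through [gapq q 0 0], and the second is a multiple of ['X^J]. *)
Lemma moment0S (K : fieldType) (q : K) J m : q != 0 -> q != 1 ->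
  'X^J %| moment q J 0 m.+1 - 'X * (qnum q m.+1 / q ^+ m)%:P * moment q J 0 m.
Proof.
move=> q0 q1; have -> : moment q J 0 m.+1
    - 'X * (qnum q m.+1 / q ^+ m)%:P * moment q J 0 m = - cert q m J.
  have -> : cert q m J = cert q m J - cert q m 0.
    rewrite [X in _ - X](_ : _ = 0) ?subr0 //.
    by rewrite /cert big_ord_recl /gapq subrr mul0r mul0r !(mulr0, mul0r).
  rewrite -(@telescope_sumr _ 0 J (cert q m)) // big_mkord.
  rewrite /moment mulr_sumr -sumrB -sumrN; apply: eq_bigr => j _.
  by rewrite opprB -cert_step // expr0 !mulr1.
by rewrite dvdpNr /cert -!mulrA mulrCA dvdp_mulr.
Qed.

(** Congruence modulo ['X^J] stands in for equality of power series in [y]. The induction on [n]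
    needs all [m] at once, since each recursion raises [m]. *)
Lemma moment_iterA (K : fieldType) (q : K) J n m : q != 0 -> q != 1 ->
  'X^J %| moment q J n m.+1 - 'X^(m.+1) * phi q%:P m (iterA q%:P 'X n).
Proof.
move=> q0 q1; have uq : (q%:P : {poly K}) \is a GRing.unit.
  by rewrite rmorph_unit ?unitfE.
elim: n m => [|n IHn] m; last first.
  have /dvdpP[a Ea] := IHn m; have /dvdpP[b Eb] := IHn m.+1.
  rewrite momentS /iterA iterS phi_opA // -/(iterA _ _ n).
  move/eqP: Ea; rewrite subr_eq => /eqP ->.
  move/eqP: Eb; rewrite subr_eq => /eqP ->.
  apply/dvdpP; exists (b + lam q m.+1 * a).
  rewrite /lam rmorph_qnum -polyCV rmorphXn /= (exprS 'X m.+1); ring.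
rewrite phi_vac //.
(* At [n = 0] both sides gain the factor ['X [m+2]/q^(m+1)] from one [m] to the next. *)
elim: m => [|m IHm].
  rewrite big_ord0 mulr1.
  have /dvdpP[a Ea] := moment00 J q0; have /dvdpP[b Eb] := moment0S J 0 q0 q1.
  apply/dvdpP; exists (b + 'X * a).
  rewrite -[moment q J 0 0](subrK 1) Ea in Eb.
  move/eqP: Eb; rewrite subr_eq qnum1 expr0 divr1 => /eqP ->.
  by rewrite expr1; ring.
have /dvdpP[a Ea] := IHm; have /dvdpP[b Eb] := moment0S J m.+1 q0 q1.
move/eqP: Eb; rewrite subr_eq => /eqP ->.
move/eqP: Ea; rewrite subr_eq => /eqP ->.
apply/dvdpP; exists (b + 'X * (qnum q m.+2 / q ^+ m.+1)%:P * a).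
rewrite big_ord_recr /= polyCM rmorph_qnum -polyCV rmorphXn /=.
by rewrite (exprS 'X m.+1); ring.
Qed.

(** * Coefficients of the moments and the formula for [Ehat] *)

Lemma coef_exp1BX (B : comNzRingType) (c : B) N i :
  ((1 - c%:P * 'X) ^+ N)`_i = (- c) ^+ i * 'C(N, i)%:R.
Proof.
elim: N i => [|N IHN] i.
  by rewrite expr0 coef1; case: i => [|i]; rewrite ?expr0 ?mul1r ?bin0n ?mulr0.
rewrite exprS mulrBl mul1r -mulrA coefB coefCM coefXM !IHN.
case: i => [|i]; first by rewrite !bin0 mulr0 subr0.
by rewrite binS natrD exprS /=; ring.
Qed.

(** The two terms of the last factor of [omega] give the two binomials; its ['X] shifts the second
    to [i - 1]. *)
Lemma coef_moment_term (K : fieldType) (q : K) N j i :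
  (omega q j * lam q j ^+ N)`_(j + i) =
    q ^- (j ^ 2) * qnum q j ^+ N * (- q ^- j) ^+ i
    * ('C(N, i)%:R * q ^+ j + (binpred N i)%:R).
Proof.
have -> : omega q j * lam q j ^+ N = 'X^j *
   ((q ^- (j ^ 2) * qnum q j ^+ N)%:P *
     (((q ^+ j)%:P - (q ^- j)%:P * 'X) * (1 - (q ^- j)%:P * 'X) ^+ N)).
  by rewrite /omega /lam exprMn polyCM (polyC_exp _ (qnum q j)); ring.
rewrite coefXnM ltnNge leq_addr /= addKn coefCM -!mulrA; do 2!congr (_ * _).
rewrite mulrBl -mulrA coefB !coefCM coefXM !coef_exp1BX.
case: i => [|i] /=; first by rewrite mulr0 subr0 !expr0; ring.
by rewrite exprS; ring.
Qed.

Lemma coef_moment (K : fieldType) (q : K) k N : q != 0 -> (0 < N)%N ->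
  (moment q k.+1 N 0)`_k =
  q ^ (k%:Z - (k ^ 2)%N%:Z) *
  \sum_(i < k)
    (-1) ^+ i * qnum q (k - i) ^+ N * q ^ (k%:Z * (i%:Z - 1)) *
    ('C(N, i)%:R * q ^+ (k - i) + (binpred N i)%:R).
Proof.
move=> q0 N0; rewrite /moment coef_sum (reindex_inj rev_ord_inj) /=.
rewrite big_ord_recr /= big_ord0 mulr1 subnn.
(* After reversal [j = k - i], the extra index [i = k] is the term [j = 0], which vanishes since
   [lam q 0 = 0] and [N > 0]. *)
have -> : omega q 0 * lam q 0 ^+ N = 0.
  by rewrite /lam qnum0 mul0r expr0n eqn0Ngt N0 mulr0.
rewrite coef0 addr0 mulr_sumr; apply: eq_bigr => i _.
rewrite big_ord0 mulr1 subSS; have le_ik : (i <= k)%N by apply: ltnW.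
have := coef_moment_term q N (k - i) i; rewrite subnK // => ->.
(* Both exponents equal [ki - k^2]. *)
have E : q ^- ((k - i) ^ 2) * q ^- (k - i) ^+ i =
    q ^ (k%:Z - (k ^ 2)%N%:Z) * q ^ (k%:Z * (i%:Z - 1)).
  rewrite -expfzDr // exprVn -exprM -invfM -exprD exprnN; congr (_ ^ _).
  by rewrite !expnS !expn0; nia.
rewrite -(mulN1r (q ^- _)) exprMn; move: E; move: (_%:R * _ + _) => b.
move: (q ^- _) (q ^- _ ^+ i) (q ^ _) (q ^ _) => u v x y E.
transitivity ((-1) ^+ i * qnum q (k - i) ^+ N * b * (u * v)); first by ring.
by rewrite E; ring.
Qed.

Lemma EhatE (R : idomainType) k N : (0 < N)%N ->
  Ehat R k N = (moment (tofrac 'X) k.+1 N 0)`_k.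
Proof.
by move=> N0; rewrite coef_moment // tofrac_eq0 -size_poly_eq0 size_polyX.
Qed.

Lemma tofracX_neq1 (R : idomainType) : tofrac ('X : {poly R}) != 1.
Proof.
rewrite -(rmorph1 (@tofrac {poly R})) tofrac_eq -subr_eq0.
by rewrite -polyC1 polyXsubC_eq0.
Qed.

(** For the generic [q] the conditions [q != 0] and [q != 1] hold, whatever value is substituted
    later. *)
Lemma tofrac_sum_wt (R : idomainType) n k :
  tofrac (\sum_(X : n.-tuple bool | count_mem true X == k) wt ('X : {poly R}) X)
    = Ehat R k.+1 n.+1.
Proof.
set q : {fraction {poly R}} := tofrac 'X.
have q0 : q != 0 by rewrite tofrac_eq0 -size_poly_eq0 size_polyX.
have q1 : q != 1 by exact: tofracX_neq1.
(* Since [lam q 0 = 0], the moment [(n+1, 0)] is the moment [(n, 1)], congruent to ['X] times the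
   generating function. Modulus ['X^(k+2)] leaves the coefficient of degree [k+1] intact. *)
rewrite EhatE // momentS /lam qnum0 !mul0r addr0.
have := moment_iterA k.+2 n 0 q0 q1; move/dvdpP => [r /eqP].
rewrite subr_eq => /eqP ->; rewrite coefD coefMXn ltnSn add0r expr1 coefXM /=.
rewrite iterAE coef_sum rmorph_sum big_mkcond; apply: eq_bigr => X _.
rewrite -[act _ _ _ _]/(wt q%:P X) -(rmorph_wt polyC) coefMC coefXn eq_sym.
by case: eqP => _; rewrite ?mul1r ?mul0r // rmorph_wt.
Qed.

(** * Motzkin paths and the partition function *)

(** Weight of a path started at height [h]. Words that go below 0 or end above it get weight 0, so
    sums can run over all words. *)
Fixpoint pathwt (B : comNzRingType) (q : B) (h : nat) (c : seq step) : B :=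
  if c is s :: c' then
    qnum q h.+1 * match s with
                  | sN => pathwt q h.+1 c'
                  | sS => if h is h'.+1 then pathwt q h' c' else 0
                  | _ => pathwt q h c'
                  end
  else (h == 0%N)%:R.

(** Row [h] of [D + E] is [[h+1]] times one up entry, one down entry and two level ones, matching
    the four steps. *)
Lemma iterA_pathwt (B : comNzRingType) (q : B) n h :
  iterA q 1 n h = \sum_(c : n.-tuple step) pathwt q h c.
Proof.
elim: n h => [|n IHn] h.
  by rewrite (big_pred1 [tuple]) // => c /=; rewrite tuple0; apply/esym/eqP.
rewrite (big_tupleS n (pathwt q h)) /iterA iterS -/(iterA q 1 n).
have sum_step (F : step -> B) :
    \sum_(s : step) F s = F sN + F sS + (F sE + F sEbar).
  rewrite (reindex step_decode); last by exists step_code => [[[] []]|[]].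
  transitivity (\sum_a \sum_b F (step_decode (a, b))).
    by rewrite pair_bigA; apply: eq_bigr => -[].
  by rewrite big_bool !big_bool.
have eqt : iterA q 1 n = fun h => \sum_(c : n.-tuple step) pathwt q h c.
  exact: functional_extensionality.
rewrite sum_step /= -!mulr_sumr.
rewrite /opA /lin /opD /opE eqt; case: h => [|h] /=; last by ring.
by rewrite big1_eq; ring.
Qed.

Definition rise (s : step) : int :=
  match s with sN => 1 | sS => -1 | _ => 0 end.

Definition hgt (c : seq step) i : int :=
  (count_mem sN (take i c))%:Z - (count_mem sS (take i c))%:Z.

Lemma hgt_cons s c i : hgt (s :: c) i.+1 = rise s + hgt c i.
Proof. by rewrite /hgt /=; case: s => /=; lia. Qed.

Lemma pathwtE (B : comNzRingType) (q : B) (c : seq step) h :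
  pathwt q h c =
    if all (fun i => 0 <= h%:Z + hgt c i) (iota 0 (size c))
       && (h%:Z + hgt c (size c) == 0)
    then \prod_(0 <= i < size c) qnum q (absz (h%:Z + hgt c i)).+1 else 0.
Proof.
have hgt0 d : hgt d 0 = 0 by rewrite /hgt take0.
elim: c h => [|s c IHc] h /=.
  by rewrite hgt0 addr0 big_geq //; case: h.
rewrite (iotaDl 1 0) all_map big_nat_recl //.
rewrite hgt0 addr0 absz_nat hgt_cons.
have shift h' : h'%:Z = h%:Z + rise s -> qnum q h.+1 * pathwt q h' c = 
   if all (preim [eta addn 1] (fun i : nat => 0 <= h%:Z + hgt (s :: c) i))
          (iota 0 (size c)) &&
     (h%:Z + (rise s + hgt c (size c)) == 0)
   then qnum q h.+1 * \prod_(0 <= i < size c)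
          qnum q (absz (h%:Z + hgt (s :: c) i.+1)).+1
   else 0.
  move=> Eh; rewrite IHc (addrA h%:Z) -Eh.
  rewrite (@eq_all _ _ (fun i : nat => 0 <= h'%:Z + hgt c i)); last first.
    by move=> i /=; rewrite add1n hgt_cons (addrA h%:Z) -Eh.
  rewrite (fun_if (fun x => qnum q h.+1 * x)) mulr0.
  congr (if _ then _ * _ else _); apply: eq_bigr => i _.
  by rewrite hgt_cons (addrA h%:Z) -Eh.
case: s shift => shift /=.
- by apply: shift => /=; lia.
- case: h shift => [|h] shift; last by apply: shift => /=; lia.
  (* A down step from height 0 reaches -1: this violates positivity if steps remain, and the final
     height condition otherwise. *)
  rewrite mulr0; case: ifP => // /andP[].
  by case: c {IHc shift} => [|s c] /=; rewrite ?hgt0.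
- by apply: shift => /=; lia.
- by apply: shift => /=; lia.
Qed.

Lemma Zpart_iterA (B : comNzRingType) (q : B) n : Zpart n q = iterA q 1 n 0%N.
Proof.
rewrite iterA_pathwt /Zpart big_mkcond; apply: eq_bigr => c _.
rewrite pathwtE size_tuple add0r big_mkord /motzkin.
rewrite (_ : all _ _ = [forall i : 'I_n, 0 <= height c i]).
  by case: ifP => // _; apply: eq_bigr => i _; rewrite add0r.
apply/allP/forallP => [H i | H i].
  by have := H i; rewrite mem_iota add0r; apply; rewrite /= add0n.
by rewrite mem_iota add0r => /= lt_in; exact: (H (Ordinal lt_in)).
Qed.

Lemma Zpart_sum_wt (B : comNzRingType) (q : B) n :
  Zpart n q = \sum_(X : n.-tuple bool) wt q X.
Proof.
by rewrite Zpart_iterA iterAE; apply: eq_bigr => X _; rewrite expr1n mul1r.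
Qed.

(** * Global balance and uniqueness *)

(** Inflow equals outflow at each state; the terms [X = Y] occur on both sides. *)
Definition balanced (R : nmodType) (T : finType) (f : T -> T -> R) : Prop :=
  forall Y, \sum_X f X Y = \sum_X f Y X.

(** By the triangle inequality the inflow of [|d|] is at least its outflow at every state. The
    excesses sum to 0, so each is 0. *)
Lemma balanced_norm (R : realFieldType) (T : finType) (off : T -> T -> R)
    (d : T -> R) : (forall X Y, 0 <= off X Y) ->
  balanced (fun X Y => d X * off X Y) ->
  balanced (fun X Y => `|d X| * off X Y).
Proof.
move=> off0 bal Y; apply/eqP; rewrite -subr_eq0; apply/eqP; move: Y.
have exc : \sum_Y (\sum_X `|d X| * off X Y - \sum_X `|d Y| * off Y X) = 0.
  by rewrite sumrB exchange_big subrr.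
move=> Y; apply: (psumr_eq0P _ exc) => // {}Y _; rewrite subr_ge0 -mulr_sumr.
rewrite -[X in _ * X]ger0_norm ?sumr_ge0 // -normrM mulr_sumr -bal.
by apply: le_trans (ler_norm_sum _ _ _) _; apply: ler_sum => X _;
  rewrite normrM (ger0_norm (off0 _ _)).
Qed.

(** Positivity spreads along moves: if [e Y = 0], balance forces zero inflow into [Y], against
    [e X * off X Y > 0]. Descent on [rank] ends at [Z]. *)
Lemma balanced_pos (R : realFieldType) (T : finType) (off : T -> T -> R)
    (e : T -> R) (Z : T) (rank : T -> nat) :
  (forall X Y, 0 <= off X Y) ->
  (forall X, X != Z -> exists2 Y, (rank Y < rank X)%N & 0 < off X Y) ->
  (forall X, 0 <= e X) -> balanced (fun X Y => e X * off X Y) ->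
  forall X, 0 < e X -> 0 < e Z.
Proof.
move=> off0 reach e0 bal X; have [r] := ubnP (rank X).
elim: r X => // r IHr X ltXr eX.
have [<- //|/reach[Y ltYX offXY]] := eqVneq X Z.
apply: (IHr Y); first exact: leq_trans ltYX _.
rewrite lt_def e0 andbT; apply/eqP => eY.
have := bal Y; rewrite -[RHS]mulr_sumr eY mul0r => /eqP.
rewrite psumr_eq0; last by move=> W _; rewrite mulr_ge0.
move/allP/(_ X); rewrite mem_index_enum => /(_ isT).
by rewrite gt_eqF ?mulr_gt0.
Qed.

(* The positive and negative parts of [d] are again balanced, and a state
   reachable from everywhere cannot carry both. *)
Lemma balanced_eq0 (R : realFieldType) (T : finType) (off : T -> T -> R)
    (d : T -> R) (Z : T) (rank : T -> nat) :
  (forall X Y, 0 <= off X Y) ->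
  (forall X, X != Z -> exists2 Y, (rank Y < rank X)%N & 0 < off X Y) ->
  balanced (fun X Y => d X * off X Y) -> \sum_X d X = 0 -> forall X, d X = 0.
Proof.
move=> off0 reach.
have nonpos (f : T -> R) : balanced (fun X Y => f X * off X Y) ->
    f Z <= 0 -> forall X, f X <= 0.
  move=> bal fZ X; rewrite leNgt; apply/negP => fX.
  have baln := balanced_norm off0 bal.
  have : 0 < `|f Z| + f Z.
    apply: (@balanced_pos _ _ off (fun X => `|f X| + f X) Z rank) (X) _ => //.
    - by move=> Y; rewrite -lerBlDr sub0r -normrN ler_norm.
    - move=> Y; under eq_bigr do rewrite mulrDl.
      under [RHS]eq_bigr do rewrite mulrDl.
      by rewrite !big_split /= baln bal.
    - by rewrite gtr0_norm // addr_gt0.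
  by rewrite ler0_norm // addNr ltxx.
(* The sign of [d Z] gives [d] a constant weak sign, and a sum of 0 then makes it vanish. *)
move=> bal sum0 X; have [dZ|dZ] := leP (d Z) 0.
  apply/eqP; rewrite -oppr_eq0; apply/eqP.
  apply: (@psumr_eq0P _ _ predT (fun X => - d X)) => //.
    by move=> Y _; rewrite oppr_ge0 nonpos.
  by rewrite sumrN sum0 oppr0.
apply: (@psumr_eq0P _ _ predT d) => // Y _; rewrite -oppr_le0.
apply: (nonpos (fun X => - d X)); last by rewrite oppr_le0 ltW.
move=> W; under eq_bigr do rewrite mulNr; under [RHS]eq_bigr do rewrite mulNr.
by rewrite !sumrN bal.
Qed.

(** * Transitions as operations on words *)

Definition hopb i (s t : seq bool) : bool :=
  (s == take i s ++ [:: true; false] ++ drop i.+2 s) &&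
  (t == take i s ++ [:: false; true] ++ drop i.+2 s).

Lemma hopbP i s t :
  reflect (exists A B, [/\ size A = i, s = A ++ [:: true, false & B]
                         & t = A ++ [:: false, true & B]]) (hopb i s t).
Proof.
apply: (iffP andP) => [[/eqP Es /eqP Et] | [A [B [<- -> ->]]]]; last first.
  rewrite take_size_cat // -[[:: true, false & B]]/([:: true; false] ++ B) catA.
  by rewrite drop_size_cat ?size_cat ?addn2 // -catA !eqxx.
exists (take i s), (drop i.+2 s); split=> //.
have := congr1 size Es; rewrite !size_cat /= size_drop size_take.
by case: ltnP => //; lia.
Qed.

Definition enterb (s t : seq bool) : bool :=
  (s == false :: behead s) && (t == true :: behead s).

Definition leaveb n (s t : seq bool) : bool :=
  (s == rcons (take n s) true) && (t == rcons (take n s) false).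

Lemma hopb_catr A a b B s :
  hopb (size A) s (A ++ [:: a, b & B]) =
    [&& ~~ a, b & s == A ++ [:: true, false & B]].
Proof.
apply/hopbP/idP => [[A' [B' [szA -> /eqP]]] | /and3P[a0 b1 /eqP->]].
  rewrite eqseq_cat // => /andP[/eqP-> /eqP[-> -> ->]].
  by rewrite /= eqxx.
by exists A, B; case: a a0 => //; case: b b1.
Qed.

Lemma hopb_catl A a b B s :
  hopb (size A) (A ++ [:: a, b & B]) s =
    [&& a, ~~ b & s == A ++ [:: false, true & B]].
Proof.
apply/hopbP/idP => [[A' [B' [szA /eqP + ->]]] | /and3P[a1 b0 /eqP->]].
  rewrite eqseq_cat // => /andP[/eqP-> /eqP[-> -> ->]].
  by rewrite /= eqxx.
by exists A, B; case: a a1 => //; case: b b0.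
Qed.

Lemma enterb_consr b s t : enterb s (b :: t) = b && (s == false :: t).
Proof.
rewrite /enterb; case: s => [|c s]; first by rewrite /= andbF.
rewrite /= !eqseq_cons !eqxx andbT /= eq_sym.
by case: b; case: c; rewrite /= ?andbT ?andbF // eq_sym.
Qed.

Lemma enterb_consl b s t : enterb (b :: s) t = ~~ b && (t == true :: s).
Proof. by rewrite /enterb /= eqseq_cons eqxx andbT; case: b. Qed.

Lemma leaveb_rconsl b s t :
  leaveb (size s) (rcons s b) t = b && (t == rcons s false).
Proof.
by rewrite /leaveb -cats1 take_size_cat // cats1 eqseq_rcons eqxx /=; case: b.
Qed.

Lemma leaveb_rconsr b s t : size s = (size t).+1 ->
  leaveb (size t) s (rcons t b) = ~~ b && (s == rcons t true).
Proof.
case/lastP: s => // s c; rewrite size_rcons => -[szs].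
rewrite -szs leaveb_rconsl !eqseq_rcons [t == s]eq_sym.
by case: b; case: c; rewrite ?andbT ?andbF.
Qed.

(** Total distance of the particles to the exit beyond the right end. *)
Fixpoint potential (s : seq bool) : nat :=
  if s is b :: s' then b * (size s').+1 + potential s' else 0.

Lemma potential_hopb i s t : hopb i s t -> potential s = (potential t).+1.
Proof.
case/hopbP => A [B [_ -> ->]]; elim: A => [|a A IHA] /=; first by lia.
by rewrite IHA !size_cat /=; lia.
Qed.

Lemma potential_leave s :
  (potential (rcons s false) < potential (rcons s true))%N.
Proof. by elim: s => //= b s IHs; rewrite !size_rcons; lia. Qed.

Lemma count_hopb i s t : hopb i s t -> count_mem true s = count_mem true t.
Proof. by case/hopbP => A [B [_ -> ->]]; rewrite !count_cat. Qed.

(** At the site of the earlier hop the two words differ, whereas a later hop leaves that site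
    unchanged. *)
Lemma hopb_uniq i j s t : hopb i s t -> hopb j s t -> i = j.
Proof.
have nlt i' j' : hopb i' s t -> hopb j' s t -> ~~ (i' < j')%N.
  move=> /hopbP[A [B [<- -> ->]]] /hopbP[A' [B' [<- Es Et]]].
  apply/negP => ltAA'; have := congr1 (nth true ^~ (size A)) Et.
  have := congr1 (nth true ^~ (size A)) Es.
  by rewrite !nth_cat ltAA' ltnn subnn /= => <-.
move=> hi hj; have := nlt _ _ hi hj; have := nlt _ _ hj hi; lia.
Qed.

Lemma count_enterb s t :
  enterb s t -> count_mem true t = (count_mem true s).+1.
Proof. by case: s => [|[] s] // /andP[_ /eqP ->]. Qed.

Lemma count_leaveb n s t :
  leaveb n s t -> count_mem true s = (count_mem true t).+1.
Proof.
case/andP => /eqP Es /eqP ->.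
by rewrite [in LHS]Es -!cats1 !count_cat /= addn1 !addn0.
Qed.

(** The nested tests become a sum because they exclude each other: [potential] separates the two hop
    directions, and the particle count separates hops, entries and exits. *)
Lemma pasep_offE (R : realFieldType) (q : R) n (X Y : state n) :
  n.+1%:R * pasep_off 1 1 q X Y =
    \sum_(i < n) (hopb i X Y)%:R + q * \sum_(i < n) (hopb i Y X)%:R
    + (enterb X Y)%:R + (leaveb n.-1 X Y)%:R.
Proof.
have sum_hop (U V : state n) : \sum_(i < n) (hopb i U V)%:R = (hop U V)%:R :> R.
  rewrite /hop; case: existsP => [[i hi] | no_hop].
    rewrite (bigD1 i) //= [hopb i U V]hi big1 ?addr0 // => j.
    have [hj|//] := boolP (hopb j U V).
    by move/eqP; case; apply: val_inj; exact: hopb_uniq hj hi.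
  apply: big1 => i _; case: (boolP (hopb i U V)) => // hi.
  by case: no_hop; exists i.
rewrite !sum_hop /pasep_off.
rewrite -[enter X Y]/(enterb X Y) -[leave X Y]/(leaveb n.-1 X Y).
have n0 : n.+1%:R != 0 :> R by rewrite pnatr_eq0.
have divn (x : R) : n.+1%:R * (x / n.+1%:R) = x by rewrite mulrC divfK.
have hopE (U V : state n) : hop U V -> exists i : nat, hopb i U V.
  by case/existsP => i hi; exists i.
case: (boolP (hop X Y)) => [/hopE[i hXY]|_].
  case: (boolP (hop Y X)) => [/hopE[j hYX]|_].
    by have := potential_hopb hXY; have := potential_hopb hYX; lia.
  case: (boolP (enterb X Y)) => [/count_enterb|_].
    by have := count_hopb hXY; lia.
  case: (boolP (leaveb n.-1 X Y)) => [/count_leaveb|_].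
    by have := count_hopb hXY; lia.
  by rewrite divn mulr0 !addr0.
case: (boolP (hop Y X)) => [/hopE[i hYX]|_].
  case: (boolP (enterb X Y)) => [/count_enterb|_].
    by have := count_hopb hYX; lia.
  case: (boolP (leaveb n.-1 X Y)) => [/count_leaveb|_].
    by have := count_hopb hYX; lia.
  by rewrite divn mulr1 add0r !addr0.
case: (boolP (enterb X Y)) => [hE|_].
  case: (boolP (leaveb n.-1 X Y)) => [/count_leaveb|_].
    by have := count_enterb hE; lia.
  by rewrite divn mulr0 !add0r addr0.
by case: ifP => _; rewrite ?divn !mulr0 !add0r.
Qed.

(** * Stationarity of the matrix weights *)

Lemma sum_tuple_eq (R : pzSemiRingType) (I : finType) n (F : seq I -> R) u :
  size u = n -> \sum_(X : n.-tuple I) F X * (tval X == u)%:R = F u.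
Proof.
move=> /eqP szu; rewrite (bigD1 (Tuple szu)) //= eqxx mulr1 big1 ?addr0 // => X.
by rewrite -val_eqE /= => /negbTE ->; rewrite mulr0.
Qed.

(* Auxiliary weights making the net flow across each bond telescope. *)
Definition hole (R : comNzRingType) (q : R) (s : seq bool) i : R :=
  (-1) ^+ (~~ nth false s i) * wt q (take i s ++ drop i.+1 s).

(** Equal letters at the bond make both sides 0; unequal ones reduce to [wt_bulk]. The factors [1 *]
    give outflow the shape of inflow, as [sum_rates] expects. *)
Lemma hop_flow (R : comNzRingType) (q : R) n (Y : state n) i : (i.+1 < n)%N ->
  \sum_(X : state n) wt q X * (hopb i X Y)%:R
  + q * \sum_(X : state n) wt q X * (hopb i Y X)%:R
  - wt q Y * (\sum_(X : state n) 1 * (hopb i Y X)%:R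
              + q * \sum_(X : state n) 1 * (hopb i X Y)%:R)
  = hole q Y i.+1 - hole q Y i.
Proof.
move=> lt_in; have szY : size Y = n by rewrite size_tuple.
move: (tval Y) szY => s szs {Y}.
have [A [a [b [B [szA Es]]]]] :
    exists A a b B, size A = i /\ s = A ++ [:: a, b & B].
  exists (take i s), (nth false s i), (nth false s i.+1), (drop i.+2 s).
  split; first by rewrite size_takel // szs ltnW // ltnW.
  by rewrite -!drop_nth ?cat_take_drop // szs // ltnW.
have szu c d : size (A ++ [:: c, d & B]) = n.
  by rewrite -szs Es !size_cat.
have hole0 : hole q s i = (-1) ^+ (~~ a) * wt q (A ++ b :: B).
  rewrite /hole Es -szA nth_cat ltnn subnn take_size_cat //.
  by rewrite -cat1s catA drop_size_cat // size_cat addn1.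
have hole1 : hole q s i.+1 = (-1) ^+ (~~ b) * wt q (A ++ a :: B).
  have E1 : s = (A ++ [:: a]) ++ b :: B by rewrite Es -catA.
  have E2 : s = (A ++ [:: a; b]) ++ B by rewrite Es -catA.
  rewrite /hole [in nth _ _ _]E1 [in take _ _]E1 [in drop _ _]E2 -szA.
  rewrite nth_cat size_cat addn1 ltnn subnn take_size_cat ?size_cat ?addn1 //.
  by rewrite drop_size_cat ?size_cat ?addn2 // -catA.
rewrite hole0 hole1 Es -szA.
under eq_bigr do rewrite hopb_catr.
under [X in q * X]eq_bigr do rewrite hopb_catl.
under [X in _ * (X + _)]eq_bigr do rewrite hopb_catl.
under [X in _ * (_ + _ * X)]eq_bigr do rewrite hopb_catr.
have sum0 F : \sum_(X : state n) F X * 0 = 0 :> R.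
  by apply: big1 => X _; rewrite mulr0.
case: a b {hole0 hole1 Es} => [] [] /=;
  rewrite ?sum0 ?mulr0 ?addr0 ?subrr ?mulr0 ?subr0 //.
all: rewrite (sum_tuple_eq (wt q)) // (sum_tuple_eq (fun _ => 1)) //.
all: by rewrite wt_bulk expr0 expr1; ring.
Qed.

Lemma hopb_lt i s t : hopb i s t -> (i.+1 < size s)%N.
Proof. by case/hopbP => A [B [<- -> _]]; rewrite size_cat /=; lia. Qed.

Lemma enter_flow (R : comNzRingType) (q : R) n (Y : state n.+1) :
  \sum_(X : state n.+1) wt q X * (enterb X Y)%:R
  - wt q Y * \sum_(X : state n.+1) 1 * (enterb Y X)%:R = hole q Y 0.
Proof.
have szY : size Y = n.+1 by rewrite size_tuple.
move: (tval Y) szY => -[|b s] //= [szs] {Y}.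
under eq_bigr do rewrite enterb_consr.
under [X in _ * X]eq_bigr do rewrite enterb_consl.
rewrite /hole /= drop0; case: b => /=.
  rewrite (sum_tuple_eq (wt q)) /= ?szs // wt_left expr0.
  by rewrite big1 ?mulr0 ?subr0 ?mul1r // => X _; rewrite mulr0.
rewrite (sum_tuple_eq (fun _ => 1)) /= ?szs // wt_left mulr1 mulN1r.
by rewrite big1 ?sub0r // => X _; rewrite mulr0.
Qed.

Lemma leave_flow (R : comNzRingType) (q : R) n (Y : state n.+1) :
  \sum_(X : state n.+1) wt q X * (leaveb n X Y)%:R
  - wt q Y * \sum_(X : state n.+1) 1 * (leaveb n Y X)%:R = - hole q Y n.
Proof.
have szY : size Y = n.+1 by rewrite size_tuple.
move: (tval Y) szY => s; case/lastP: s => // s b.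
rewrite size_rcons => -[<-] {Y}.
under eq_bigr => X _ do rewrite leaveb_rconsr ?size_tuple //.
under [X in _ * X]eq_bigr do rewrite leaveb_rconsl.
rewrite /hole nth_rcons ltnn eqxx -[rcons s b]cats1 take_size_cat //.
rewrite drop_oversize ?size_cat ?addn1 // cats0 cats1; case: b => /=.
  rewrite (sum_tuple_eq (fun _ => 1)) ?size_rcons // wt_right expr0.
  by rewrite big1 ?sub0r ?mulr1 ?mul1r // => X _; rewrite mulr0.
rewrite (sum_tuple_eq (wt q)) ?size_rcons // wt_right expr1 mulN1r opprK.
by rewrite big1 ?mulr0 ?subr0 // => X _; rewrite mulr0.
Qed.

Lemma sum_rates (R : comNzRingType) (q : R) n (T : finType)
    (f e l : T -> R) (h1 h2 : 'I_n -> T -> R) :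
  \sum_X f X * (\sum_i h1 i X + q * \sum_i h2 i X + e X + l X) =
    \sum_i (\sum_X f X * h1 i X + q * \sum_X f X * h2 i X)
    + \sum_X f X * e X + \sum_X f X * l X.
Proof.
rewrite [\sum_i (_ + _)]big_split -mulr_sumr /=.
rewrite (exchange_big_dep predT) //= [X in q * X](exchange_big_dep predT) //=.
rewrite mulr_sumr -!big_split; apply: eq_bigr => X _ /=.
by rewrite -!mulr_sumr; ring.
Qed.

Lemma wt_balanced (R : realFieldType) (q : R) n : (0 < n)%N ->
  balanced (fun X Y : state n => wt q X * pasep_off 1 1 q X Y).
Proof.
case: n => // n _ Y; have n0 : n.+2%:R != 0 :> R by rewrite pnatr_eq0.
apply: (mulfI n0); rewrite -mulr_sumr [RHS]mulrCA !mulr_sumr.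
transitivity (\sum_(X : state n.+1) wt q X *
  (\sum_(i < n.+1) (hopb i X Y)%:R + q * \sum_(i < n.+1) (hopb i Y X)%:R
   + (enterb X Y)%:R + (leaveb n X Y)%:R)).
  by apply: eq_bigr => X _; rewrite mulrCA pasep_offE.
transitivity (wt q Y * \sum_(X : state n.+1) 1 *
  (\sum_(i < n.+1) (hopb i Y X)%:R + q * \sum_(i < n.+1) (hopb i X Y)%:R
   + (enterb Y X)%:R + (leaveb n Y X)%:R)); last first.
  by rewrite mulr_sumr; apply: eq_bigr => X _; rewrite mul1r pasep_offE.
rewrite (sum_rates q (fun X : state n.+1 => wt q X)
  (fun X => (enterb X Y)%:R) (fun X => (leaveb n X Y)%:R)
  (fun i X => (hopb i X Y)%:R) (fun i X => (hopb i Y X)%:R)).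
rewrite (sum_rates q (fun=> 1)
  (fun X : state n.+1 => (enterb Y X)%:R) (fun X => (leaveb n Y X)%:R)
  (fun i X => (hopb i Y X)%:R) (fun i X => (hopb i X Y)%:R)).
(* There are [n.+1] cells but only [n] bonds, so the last index contributes nothing. *)
have flow i : \sum_(X : state n.+1) wt q X * (hopb i X Y)%:R
  + q * \sum_(X : state n.+1) wt q X * (hopb i Y X)%:R
  - wt q Y * (\sum_(X : state n.+1) 1 * (hopb i Y X)%:R
              + q * \sum_(X : state n.+1) 1 * (hopb i X Y)%:R)
  = if (i < n)%N then hole q Y i.+1 - hole q Y i else 0.
  case: ltnP => [lt_in|le_ni]; first exact: hop_flow.
  have no_hop (U V : state n.+1) : hopb i U V = false.
    by apply/negP => /hopb_lt; rewrite size_tuple; lia.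
  rewrite !big1 ?mulr0 ?addr0 ?mulr0 ?subr0 // => X _; rewrite no_hop mulr0 //.
(* The bulk telescopes to [hole q Y n - hole q Y 0], cancelled by the entry and exit flows. *)
have sum_flow : \sum_(i < n.+1)
    (if (i < n)%N then hole q Y i.+1 - hole q Y i else 0)
   = hole q Y n - hole q Y 0.
  rewrite big_ord_recr /= ltnn addr0 -(telescope_sumr (hole q Y)) // big_mkord.
  by apply: eq_bigr => i _; rewrite ltn_ord.
move: sum_flow; under eq_bigr do rewrite -flow.
rewrite sumrB -[X in _ - X = _]mulr_sumr /=.
have := enter_flow q Y; have := leave_flow q Y.
by lra.
Qed.

(** * Draining to the empty configuration *)

(** The rightmost particle is either in the last cell or followed by an empty one. *)
Lemma exists_exit (s : seq bool) : true \in s ->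
  (exists s', s = rcons s' true) \/
  (exists A B, s = A ++ [:: true, false & B]).
Proof.
elim: s => // b s IHs; rewrite inE => mem_s.
have [/IHs[[s' ->]|[A [B ->]]]|s_empty] := boolP (true \in s).
- by left; exists (b :: s').
- by right; exists (b :: A), B.
move: mem_s; rewrite (negbTE s_empty) orbF => /eqP <-.
case: s s_empty {IHs} => [|[] s] // _; first by left; exists [::].
by right; exists [::], s.
Qed.

Lemma pasep_off_ge0 (R : realFieldType) (q : R) n (X Y : state n) :
  0 <= q -> 0 <= pasep_off 1 1 q X Y.
Proof.
by move=> q0; rewrite /pasep_off; do !case: ifP => _ //; rewrite divr_ge0.
Qed.

(** Leaving on the right and hopping forward both lower [potential], at a rate free of [q] and hence
    positive even at [q = 0]. *)
Lemma pasep_exit (R : realFieldType) (q : R) n (X : state n) : 0 <= q ->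
  X != [tuple of nseq n false] ->
  exists2 Y : state n, (potential Y < potential X)%N
                       & 0 < pasep_off 1 1 q X Y.
Proof.
move=> q0 X_ne.
have memX : true \in tval X.
  apply: contraNT X_ne => noX; apply/eqP/val_inj => /=.
  have szX : size X = n by rewrite size_tuple.
  rewrite -[in RHS]szX; apply/all_pred1P/allP => -[] //=.
  by move/negP: noX.
have sumn_ge0 (I : finType) (b : I -> bool) : 0 <= \sum_i (b i)%:R :> R.
  by apply: sumr_ge0 => i _; rewrite ler0n.
have pos Y : 0 < n.+1%:R * pasep_off 1 1 q X Y -> 0 < pasep_off 1 1 q X Y.
  by rewrite pmulr_rgt0 // ltr0n.
case: (exists_exit memX) => [[s Es]|[A [B Es]]].
  have szs : size (rcons s false) == n.
    by rewrite -(size_tuple X) Es !size_rcons.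
  have Es' : n.-1 = size s by rewrite -(eqP szs) size_rcons.
  exists (Tuple szs); first by rewrite Es potential_leave.
  apply: pos; rewrite pasep_offE /= Es' Es leaveb_rconsl eqxx /=.
  by rewrite ltr_wpDl // !addr_ge0 ?mulr_ge0 ?sumn_ge0.
have szs : size (A ++ [:: false, true & B]) == n.
  by rewrite -(size_tuple X) Es !size_cat.
have hX : hopb (size A) X (Tuple szs) by rewrite Es hopb_catl eqxx.
exists (Tuple szs); first by rewrite (potential_hopb hX).
apply: pos; rewrite pasep_offE -!addrA ltr_pwDl //; last first.
  by rewrite !addr_ge0 ?mulr_ge0 ?sumn_ge0.
have lt_An : (size A < n)%N.
  by rewrite ltnW // -[X in (_ < X)%N](size_tuple X) (hopb_lt hX).
rewrite (bigD1 (Ordinal lt_An)) //= hX ltr_pwDl //.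
by apply: sumr_ge0 => i _; rewrite ler0n.
Qed.

(** * The stationary distribution and its particle count *)

(** The sums may include [X = Y]: the term with [pasep_off 1 1 q Y Y] occurs in both and cancels. *)
Lemma pasep_sum (R : fieldType) (q : R) n (f : state n -> R) Y :
  \sum_X f X * pasep 1 1 q X Y
   = f Y + \sum_X f X * pasep_off 1 1 q X Y - \sum_X f Y * pasep_off 1 1 q Y X.
Proof.
have -> : \sum_X f Y * pasep_off 1 1 q Y X = f Y * pasep_off 1 1 q Y Y
    + f Y * \sum_(X | X != Y) pasep_off 1 1 q Y X.
  by rewrite -mulr_sumr (bigD1 Y) //= mulrDr.
rewrite (bigD1 Y) //= [in RHS](bigD1 Y) //= {1}/pasep eqxx.
rewrite [X in _ + X = _](eq_bigr (fun X => f X * pasep_off 1 1 q X Y)).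
  by ring.
by move=> X /negbTE neXY; rewrite /pasep neXY.
Qed.

Lemma stationary_balanced (R : realFieldType) (q : R) n
    (f : {ffun state n -> R}) :
  (forall Y, \sum_X f X * pasep 1 1 q X Y = f Y) <->
  balanced (fun X Y : state n => f X * pasep_off 1 1 q X Y).
Proof.
split=> [stat Y | bal Y]; last by rewrite pasep_sum bal addrK.
by have := stat Y; rewrite pasep_sum; lra.
Qed.

Lemma wt_empty (B : comNzRingType) (q : B) n : wt q (nseq n false) = 1.
Proof. by elim: n => //= n IHn; rewrite wt_left. Qed.

Lemma Zpart_gt0 (R : realFieldType) (q : R) n : 0 <= q -> 0 < Zpart n q.
Proof.
move=> q0; rewrite Zpart_sum_wt (bigD1 [tuple of nseq n false]) //= wt_empty.
by rewrite ltr_pwDl // sumr_ge0 // => X _; exact: wt_ge0.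
Qed.

Theorem theorem4 (R : realFieldType) (n : nat) (q : R)
    (hn : (1 <= n)%N) (hq : 0 <= q <= 1) :
  exists2 mu : {ffun state n -> R},
    unique (stationary (pasep (n := n) 1 1 q)) mu &
    forall k : nat, (k <= n)%N ->
      exists2 P : {poly R}, tofrac P = Ehat R k.+1 n.+1 &
        \sum_(X : state n | nblack X == k) mu X = P.[q] / Zpart n q.
Proof.
case/andP: hq => q0 _; have Z0 := Zpart_gt0 n q0.
pose mu : {ffun state n -> R} := [ffun X : state n => wt q X / Zpart n q].
have stat_mu : stationary (pasep (n := n) 1 1 q) mu.
  split=> [X||].
  - by rewrite ffunE divr_ge0 ?wt_ge0 // ltW.
  - under eq_bigr do rewrite ffunE.
    by rewrite -mulr_suml -Zpart_sum_wt divff // gt_eqF.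
  - apply/stationary_balanced => Y.
    under eq_bigr do rewrite ffunE mulrAC.
    under [RHS]eq_bigr do rewrite ffunE mulrAC.
    by rewrite -!mulr_suml (wt_balanced q hn).
exists mu => [|k _].
  split=> // nu [_ sum_nu stat_nu].
  have [_ sum_mu /stationary_balanced bal_mu] := stat_mu.
  move/stationary_balanced: stat_nu => bal_nu.
  apply/ffunP => X; apply/eqP; rewrite -subr_eq0; apply/eqP; move: X.
  apply: (@balanced_eq0 _ _ (fun X Y : state n => pasep_off 1 1 q X Y)
    (fun X => mu X - nu X) [tuple of nseq n false]
    (fun X : state n => potential X)).
  - by move=> X Y; exact: pasep_off_ge0.
  - by move=> X; exact: pasep_exit.
  - move=> Y; under eq_bigr do rewrite mulrBl.
    under [RHS]eq_bigr do rewrite mulrBl.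
    by rewrite !sumrB bal_mu bal_nu.
  - by rewrite sumrB sum_mu sum_nu subrr.
(* The weights at generic [q] add up to the polynomial behind [Ehat]; evaluation at [q] is a ring
   morphism and carries them to the numerical weights. *)
exists (\sum_(X : n.-tuple bool | count_mem true X == k) wt ('X : {poly R}) X).
  exact: tofrac_sum_wt.
under eq_bigr do rewrite ffunE.
rewrite -mulr_suml; congr (_ / _); rewrite -horner_evalE rmorph_sum.
by apply: eq_bigr => X _; rewrite rmorph_wt /= horner_evalE hornerX.
Qed.
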